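(* The gap Laplacian $L^\Delta$ is positive semidefinite. More precisely, for any $\mathbf v=(\mathbf v_2,\dots,\mathbf v_N)\in\mathbb R^{2(N-1)}$ (with $\mathbf v_a\in\mathbb R^2$), $$\mathbf v^TL^\Delta\mathbf v=\sum_{a=2}^N\delta_{1a}(\mathbf v_a\cdot\hat{\mathbf q}_{1a})^2+\sum_{2\le a<b\le N}\delta_{ab}\bigl((\mathbf v_a-\mathbf v_b)\cdot\hat{\mathbf q}_{ab}\bigr)^2\ge0.$$
   Context: Let $m_1,\dots,m_N>0$, $M=\sum_i m_i$, and let $\mathbf r_1,\dots,\mathbf r_N\in\mathbb R^2$ be pairwise distinct positions. Put $\mathbf q_{ij}=\mathbf r_i-\mathbf r_j$, $q_{ij}=|\mathbf q_{ij}|$, $\hat{\mathbf q}_{ij}=\mathbf q_{ij}/q_{ij}$, $\mu_{ij}=m_im_j/M$, $\delta_{ij}=3M\mu_{ij}/q_{ij}^3$, and $\mathbf D_{ij}=\mathbf D_{ji}=\delta_{ij}\hat{\mathbf q}_{ij}\hat{\mathbf q}_{ij}^T\in\mathbb R^{2\times2}$. The gap Laplacian $L^\Delta$ is the $2(N-1)\times2(N-1)$ matrix consisting of an $(N-1)\times(N-1)$ array of $2\times2$ blocks indexed by bodies $a,b\in\{2,\dots,N\}$: $(L^\Delta)_{a-1,a-1}=\sum_{k\ne a}\mathbf D_{ak}$ (sum over $k\in\{1,\dots,N\}$, $k\neq a$) and $(L^\Delta)_{a-1,b-1}=-\mathbf D_{ab}$ for $a\ne b$. *)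

(* Defs.v *)
From mathcomp Require Import all_boot all_order all_algebra.
From mathcomp Require Import reals.

Set Implicit Arguments.
Unset Strict Implicit.
Unset Printing Implicit Defensive.

Import Order.TTheory GRing.Theory Num.Theory.
Local Open Scope ring_scope.

Definition dotv (R : realType) (d : nat) (u v : 'cV[R]_d) : R :=
  \sum_(k < d) u k ord0 * v k ord0.

(* Euclidean norm; the norm MathComp-Analysis puts on matrices is the sup
   norm. *)
Definition enorm (R : realType) (d : nat) (u : 'cV[R]_d) : R :=
  Num.sqrt (dotv u u).

Definition quadform (R : realType) (d : nat) (A : 'M[R]_d) (v : 'cV[R]_d) : R :=
  (v^T *m A *m v) ord0 ord0.

Definition psdmx (R : realType) (d : nat) (A : 'M[R]_d) : Prop :=
  A^T = A /\ forall v : 'cV[R]_d, 0 <= quadform A v.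

(* The number of bodies is N = n.+1. Body 1 is [ord0 : 'I_n.+1] and the bodies
   2, ..., N are the [body i] for i : 'I_n, in increasing order. *)
Definition body (n : nat) (i : 'I_n) : 'I_n.+1 := lift ord0 i.

Section GapLaplacian.
Variables (R : realType) (n : nat).
Variables (m : 'I_n.+1 -> R) (r : 'I_n.+1 -> 'cV[R]_2).
Implicit Types i j : 'I_n.+1.

Definition total_mass : R := \sum_i m i.

Definition gap i j : 'cV[R]_2 := r i - r j.

Definition gap_norm i j : R := enorm (gap i j).

Definition gap_dir i j : 'cV[R]_2 := (gap_norm i j)^-1 *: gap i j.

Definition red_mass i j : R := m i * m j / total_mass.

Definition delta i j : R := 3 * total_mass * red_mass i j / gap_norm i j ^+ 3.

Definition Dmx i j : 'M[R]_2 := delta i j *: (gap_dir i j *m (gap_dir i j)^T).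

(* The dimension \sum_(a < n) 2 is the mxblock form of 2(N-1). *)
Definition gap_laplacian : 'M[R]_(\sum_(a < n) 2) :=
  \mxblock_(a < n, b < n)
    (if a == b then \sum_(k | k != body a) Dmx (body a) k
     else - Dmx (body a) (body b)).

End GapLaplacian.

(* Main.v *)
(** The form v^T L v is an ordered double sum over pairs of distinct bodies.
    Since delta is symmetric and the direction of q_ab is antisymmetric, adding
    the contributions of (a, b) and (b, a) completes the square
    delta_ab ((v_a - v_b) . q_ab)^2; body 1 enters the diagonal blocks only,
    which leaves the terms delta_1a (v_a . q_1a)^2. *)

Require Import Defs.
From mathcomp Require Import all_boot all_order all_algebra.
From mathcomp Require Import reals.
From mathcomp Require Import ring.

Set Implicit Arguments.
Unset Strict Implicit.
Unset Printing Implicit Defensive.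

Import Order.TTheory GRing.Theory Num.Theory.
Local Open Scope ring_scope.

(** Each ordered pair of distinct indices has either [a < b] or [b < a]; exchanging the two sums
    over the second kind turns its terms into [F b a] with [a < b]. *)
Lemma sum_offdiag (V : nmodType) n (F : 'I_n -> 'I_n -> V) :
  \sum_a \sum_(b | b != a) F a b =
  \sum_(a < n) \sum_(b < n | (a < b)%N) (F a b + F b a).
Proof.
under [RHS]eq_bigr do rewrite big_split /=.
rewrite big_split /= [X in _ = _ + X](exchange_big_dep predT) //= -big_split /=.
apply: eq_bigr => a _.
rewrite (bigID (fun b : 'I_n => (a < b)%N)) /=; congr (_ + _); apply: eq_bigl => b.
  by rewrite -val_eqE; case: ltngtP.
by rewrite -val_eqE; case: ltngtP.
Qed.

Section Dot.
Variables (R : realType) (d : nat).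
Implicit Types u v g : 'cV[R]_d.

Lemma dotvE u v : (u^T *m v) ord0 ord0 = dotv u v.
Proof. by rewrite mxE; apply: eq_bigr => k _; rewrite mxE. Qed.

Lemma dotvC u v : dotv u v = dotv v u.
Proof. by apply: eq_bigr => k _; rewrite mulrC. Qed.

Lemma dotvNr u v : dotv u (- v) = - dotv u v.
Proof. by rewrite /dotv -sumrN; apply: eq_bigr => k _; rewrite mxE mulrN. Qed.

Lemma dotvBl u v g : dotv (u - v) g = dotv u g - dotv v g.
Proof. by rewrite /dotv -sumrB; apply: eq_bigr => k _; rewrite !mxE mulrBl. Qed.

Lemma bilinear_rank1 u g v :
  (u^T *m (g *m g^T) *m v) ord0 ord0 = dotv u g * dotv v g.
Proof.
by rewrite mulmxA -mulmxA mxE big_ord1 !dotvE (dotvC g).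
Qed.

End Dot.

Lemma quadform_mxblock (R : realType) n (p : 'I_n -> nat)
    (B : forall a b, 'M[R]_(p a, p b)) (v : forall a, 'cV[R]_(p a)) :
  quadform (\mxblock_(a < n, b < n) B a b) (\mxcol_(a < n) v a) =
  \sum_a \sum_b ((v a)^T *m B a b *m v b) ord0 ord0.
Proof.
rewrite /quadform tr_mxcol mul_mxrow_mxblock mul_mxrow_mxcol summxE exchange_big.
by apply: eq_bigr => b _; rewrite mulmx_suml summxE.
Qed.

Section Laplacian.
Variables (R : realType) (n : nat).
Variables (m : 'I_n.+1 -> R) (r : 'I_n.+1 -> 'cV[R]_2).
Implicit Types (i j : 'I_n.+1) (a b : 'I_n) (u v : 'cV[R]_2).

Lemma gap_normC i j : gap_norm r i j = gap_norm r j i.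
Proof.
by congr Num.sqrt; apply: eq_bigr => k _; rewrite !mxE -mulrNN !opprB.
Qed.

Lemma gap_dirC i j : gap_dir r i j = - gap_dir r j i.
Proof. by rewrite /gap_dir gap_normC -scalerN /gap opprB. Qed.

Lemma deltaC i j : delta m r i j = delta m r j i.
Proof. by rewrite /delta /red_mass gap_normC (mulrC (m i)). Qed.

Lemma delta_ge0 i j : (forall k, 0 < m k) -> 0 <= delta m r i j.
Proof.
move=> m_gt0; have m_ge0 k : 0 <= m k by exact: ltW.
have M_ge0 : 0 <= total_mass m by apply: sumr_ge0.
by rewrite /delta /red_mass !(divr_ge0, mulr_ge0, exprn_ge0, sqrtr_ge0).
Qed.

(** The direction changes sign in both factors of the rank-one product, so the signs cancel. *)
Lemma DmxC i j : Dmx m r i j = Dmx m r j i.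
Proof. by rewrite /Dmx deltaC gap_dirC linearN /= mulmxN mulNmx opprK. Qed.

Lemma trmx_Dmx i j : (Dmx m r i j)^T = Dmx m r i j.
Proof. by rewrite /Dmx linearZ /= trmx_mul trmxK. Qed.

Lemma bilinear_Dmx i j u v :
  (u^T *m Dmx m r i j *m v) ord0 ord0 =
  delta m r i j * (dotv u (gap_dir r i j) * dotv v (gap_dir r i j)).
Proof. by rewrite /Dmx -scalemxAr -scalemxAl mxE bilinear_rank1. Qed.

Lemma trmx_gap_laplacian : (gap_laplacian m r)^T = gap_laplacian m r.
Proof.
rewrite /gap_laplacian tr_mxblock; apply: eq_mxblock => a b.
rewrite eq_sym; case: eqP => [->|_]; last by rewrite linearN /= trmx_Dmx DmxC.
by rewrite linear_sum; apply: eq_bigr => k _; exact: trmx_Dmx.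
Qed.

(** Separates body 1, which has no block row of its own, from the neighbours of [body a] that do. *)
Lemma sum_neq_body (V : nmodType) (F : 'I_n.+1 -> V) a :
  \sum_(k | k != body a) F k = F ord0 + \sum_(b | b != a) F (body b).
Proof.
by rewrite big_mkcond big_ord_recl /= -big_mkcond; congr (_ + _).
Qed.

Lemma quadform_gap_laplacian (v : 'I_n -> 'cV[R]_2) :
  quadform (gap_laplacian m r) (\mxcol_(a < n) v a) =
  \sum_(a < n) delta m r ord0 (body a)
      * dotv (v a) (gap_dir r ord0 (body a)) ^+ 2
  + \sum_(a < n) \sum_(b < n | (a < b)%N) delta m r (body a) (body b)
      * dotv (v a - v b) (gap_dir r (body a) (body b)) ^+ 2.
Proof.
pose x a b c := dotv (v c) (gap_dir r (body a) (body b)).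
rewrite quadform_mxblock.
(* Row [a] of the form: the diagonal block gives the squares, including the one for body 1, and each
   block [(a, b)] off the diagonal gives one cross term. The cross term is kept next to the square
   with the same [delta], ready for pairing with row [b]. *)
transitivity (\sum_a (delta m r ord0 (body a)
      * dotv (v a) (gap_dir r ord0 (body a)) ^+ 2
  + \sum_(b | b != a) delta m r (body a) (body b)
      * (x a b a ^+ 2 - x a b a * x a b b))).
  apply: eq_bigr => a _; rewrite (bigD1 a) //= eqxx.
  rewrite mulmx_sumr mulmx_suml summxE sum_neq_body -addrA; congr (_ + _).
    (* The diagonal block holds the direction from [body a] to body 1 reversed with respect to the
       goal; squaring removes the sign. *)
    by rewrite bilinear_Dmx deltaC gap_dirC dotvNr mulrNN expr2.
  rewrite -big_split /=; apply: eq_bigr => b neq_ba.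
  rewrite eq_sym (negPf neq_ba) mulmxN mulNmx [X in _ + X]mxE !bilinear_Dmx.
  by rewrite /x; ring.
rewrite big_split /= sum_offdiag; congr (_ + _).
apply: eq_bigr => a _; apply: eq_bigr => b _.
(* Once the [(b, a)] term is expressed with the direction of [(a, b)], the two terms read
   [s^2 - s t] and [t^2 - t s] with a common factor [delta], and they add up to [(s - t)^2]. *)
rewrite /x (deltaC (body b)) (gap_dirC (body b)) !dotvNr dotvBl.
by ring.
Qed.

End Laplacian.

Theorem proposition4p4 (R : realType) (n : nat)
    (m : 'I_n.+1 -> R) (r : 'I_n.+1 -> 'cV[R]_2)
    (m_gt0 : forall i, 0 < m i) (r_inj : injective r) :
  psdmx (gap_laplacian m r) /\
  forall v : 'I_n -> 'cV[R]_2,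
    let S :=
      \sum_(a < n) delta m r ord0 (body a)
          * dotv (v a) (gap_dir r ord0 (body a)) ^+ 2
      + \sum_(a < n) \sum_(b < n | (a < b)%N) delta m r (body a) (body b)
          * dotv (v a - v b) (gap_dir r (body a) (body b)) ^+ 2 in
    quadform (gap_laplacian m r) (\mxcol_(a < n) v a) = S /\ 0 <= S.
Proof.
have quadform_ge0 (v : 'I_n -> 'cV[R]_2) :
    0 <= quadform (gap_laplacian m r) (\mxcol_(a < n) v a).
  rewrite quadform_gap_laplacian addr_ge0 ?sumr_ge0 // => a _.
    by rewrite mulr_ge0 ?sqr_ge0 ?delta_ge0.
  by apply: sumr_ge0 => b _; rewrite mulr_ge0 ?sqr_ge0 ?delta_ge0.
split; last by move=> v S; rewrite /S -quadform_gap_laplacian.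
split; first exact: trmx_gap_laplacian.
(* Every column vector is the stack of its blocks of height 2, so [quadform_ge0] covers all of
   them. *)
by move=> v; rewrite -(submxcolK v).
Qed.
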